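(* The class of lattice path matroids is pigeonhole.
   Context: All matroids are finite. Lattice path matroids. For a string $P=p_1\cdots p_s$ over $\{E,N\}$ let $n_i(P)$ be the number of $N$s among $p_1,\ldots,p_i$ and $N(P)=\{i: p_i=N\}$. For strings of equal length $s$ write $P\preccurlyeq Q$ if $n_i(P)\le n_i(Q)$ for all $i\in\{1,\ldots,s\}$. Let $P\preccurlyeq Q$ each consist of $r$ copies of $N$ and $m$ copies of $E$. The lattice path matroid $M[P,Q]$ has ground set $\{1,\ldots,m+r\}$ and bases $N(L)$ for all strings $L$ with $r$ copies of $N$ and $m$ copies of $E$ satisfying $P\preccurlyeq L\preccurlyeq Q$. For a matroid $M$ and $U\subseteq E(M)$, let $\lambda_M(U)=r_M(U)+r_M(E(M)-U)-r(M)$. For $X,X'\subseteq U$, write $X\sim_U X'$ if for every $Z\subseteq E(M)-U$, $X\cup Z$ is independent in $M$ iff $X'\cup Z$ is independent in $M$. A subcubic tree is a tree in which every vertex has degree three or one; degree-one vertices are leaves. A decomposition of $M$ is a pair $(T,\varphi)$ with $T$ a subcubic tree and $\varphi$ a bijection from $E(M)$ to the leaves of $T$. Deleting an edge $e$ of $T$ splits the leaves into two parts, giving a partition $(U_e,V_e)$ of $E(M)$; the sets $U_e$ and $V_e$ are displayed by $e$. The branch-width $\mathrm{bw}(M)$ is the minimum over decompositions $(T,\varphi)$ of the maximum of $\lambda_M(U_e)+1$ over edges $e$ of $T$. The decomposition-width $\mathrm{dw}(M)$ is the minimum over decompositions $(T,\varphi)$ of the maximum number of equivalence classes of $\sim_U$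 over all sets $U$ displayed by an edge of $T$. A class $\mathcal{M}$ of matroids is pigeonhole if for every positive integer $\lambda$ there is an integer $\rho(\lambda)$ such that $\mathrm{bw}(M)\le\lambda$ implies $\mathrm{dw}(M)\le\rho(\lambda)$ for every $M\in\mathcal{M}$. *)

(* Defs.v *)
From mathcomp Require Import all_boot zify.
From mathcomp Require Import boolp.

Set Implicit Arguments.
Unset Strict Implicit.
Unset Printing Implicit Defensive.

(* The ground set is the whole finite type E. *)
Record matroid (E : finType) := Matroid {
  bases : {set {set E}};
  bases_neq0 : bases != set0;
  bases_exchange : forall B1 B2 x, B1 \in bases -> B2 \in bases ->
    x \in B1 :\: B2 ->
    exists2 y, y \in B2 :\: B1 & y |: (B1 :\ x) \in bases
}.

Section Matroid.
Variables (E : finType) (M : matroid E).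
Implicit Types U X Z : {set E}.

Definition indep X : bool := [exists B in bases M, X \subset B].

Definition rank U : nat := \max_(X in powerset U | indep X) #|X|.

(* The truncated subtraction is harmless: rank is subadditive. *)
Definition lambda U : nat := rank U + rank (~: U) - rank [set: E].

Definition sim U X X' : bool :=
  [forall Z in powerset (~: U), indep (X :|: Z) == indep (X' :|: Z)].

Definition num_classes U : nat :=
  #|equivalence_partition (sim U) (powerset U)|.

End Matroid.

Definition isomorphic (E E' : finType) (M : matroid E) (M' : matroid E') :=
  exists2 f : E -> E', bijective f &
    forall B : {set E}, (B \in bases M) = (f @: B \in bases M').

Section Tree.
Variables (V : finType) (e : rel V).

Definition degree v : nat := #|[set w | e v w]|.

Definition leaf v : bool := degree v == 1.

(* An edge traversed back and forth is a ucycle of size 2, hence the bound. *)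
Definition acyclic := forall p : seq V, ucycle e p -> size p <= 2.

Definition is_tree :=
  [/\ symmetric e, irreflexive e, 0 < #|V|, forall u v, connect e u v & acyclic].

Definition subcubic_tree :=
  is_tree /\ forall v, degree v = 3 \/ degree v = 1.

Definition delete_edge u v : rel V :=
  [rel x y | e x y && ([set x; y] != [set u; v])].

End Tree.

Record decomposition (E : finType) := Decomposition {
  node : finType;
  adj : rel node;
  phi : E -> node;
  adj_subcubic : subcubic_tree adj;
  phi_inj : injective phi;
  phi_leaves : codom phi =i leaf adj
}.

Section Width.
Variable E : finType.

(* The part, after deleting the edge uv, on the side of u; the other part is
   displayed D v u. *)
Definition displayed (D : decomposition E) (u v : node D) : {set E} :=
  [set x | connect (delete_edge (@adj _ D) u v) u (phi D x)].

(* Maximum of g over all sets displayed by an edge; edges are taken with both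
   orientations, so that both parts are considered. *)
Definition max_displayed (g : {set E} -> nat) (D : decomposition E) : nat :=
  \max_(uv : node D * node D | adj uv.1 uv.2) g (displayed uv.1 uv.2).

(* Least element of S, and 0 if S is empty. *)
Definition min_nat (S : nat -> Prop) : nat :=
  if pselect (exists k, `[< S k >]) is left exS then ex_minn exS else 0.

(* There is no decomposition when #|E| <= 1, as a subcubic tree has at least two
   leaves; both widths are then 0 by convention. *)
Definition branch_width (M : matroid E) : nat :=
  min_nat (fun k => exists D : decomposition E,
    max_displayed (fun U => (lambda M U).+1) D = k).

Definition decomposition_width (M : matroid E) : nat :=
  min_nat (fun k => exists D : decomposition E,
    max_displayed (num_classes M) D = k).

End Width.

Definition matroid_class := forall E : finType, matroid E -> Prop.

Definition pigeonhole (C : matroid_class) :=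
  forall l : nat, 0 < l -> exists rho : nat,
    forall (E : finType) (M : matroid E), C E M ->
      branch_width M <= l -> decomposition_width M <= rho.

Section LatticePath.
Variables m r : nat.

(* Strings over {E, N} are boolean tuples, with N encoded as true; positions
   are numbered from 0. *)
Definition Nset (P : (m + r).-tuple bool) : {set 'I_(m + r)} :=
  [set i | tnth P i].

Definition lattice_path := {P : (m + r).-tuple bool | #|Nset P| == r}.

(* The number of N's among the first i letters. *)
Definition nN (i : nat) (P : lattice_path) : nat :=
  #|[set j in Nset (val P) | j < i]|.

Definition path_le (P Q : lattice_path) : bool :=
  [forall i : 'I_(m + r), nN i.+1 P <= nN i.+1 Q].

Definition lpm_bases (P Q : lattice_path) : {set {set 'I_(m + r)}} :=
  [set Nset (val L) | L : lattice_path & path_le P L && path_le L Q].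

Lemma lpm_bases_neq0 P Q : path_le P Q -> lpm_bases P Q != set0.
Proof.
move=> PQ; apply/set0Pn; exists (Nset (val P)); apply: imset_f.
by rewrite inE PQ andbT; apply/forallP.
Qed.

Let cnt (B : {set 'I_(m + r)}) i := #|[set j in B | j < i]|.

Let cntE B i : cnt B i = \sum_(j in B) (j < i).
Proof.
rewrite /cnt -sum1_card [RHS]big_mkcond [LHS]big_mkcond /=.
by apply: eq_bigr => j _; rewrite inE; case: (j \in B); case: (j < i).
Qed.

Let cnt_full B i : m + r <= i -> cnt B i = #|B|.
Proof.
move=> le_i; rewrite /cnt; congr #|pred_of_set _|; apply/setP => j.
by rewrite inE (leq_trans (ltn_ord j) le_i) andbT.
Qed.

Let cnt0 B : cnt B 0 = 0.
Proof. by apply/eqP; rewrite cards_eq0; apply/eqP/setP => j; rewrite !inE andbF. Qed.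

Let cntS B (i : 'I_(m + r)) : cnt B i.+1 = cnt B i + (i \in B).
Proof.
rewrite !cntE !(big_mkcond (mem B)) /= (bigD1 i) //= [in RHS](bigD1 i) //=.
rewrite ltnn ltnSn.
under eq_bigr => j ne_ji.
  rewrite ltnS leq_eqVlt (_ : (_ == _) = false) /=; last exact/negbTE.
  over.
by case: (i \in B); lia.
Qed.

Let cnt_swap (B : {set _}) x y i : x \in B -> y \notin B ->
  cnt (y |: (B :\ x)) i + (x < i) = cnt B i + (y < i).
Proof.
move=> xB yB; rewrite !cntE big_setU1 ?inE ?(negbTE yB) ?andbF //=.
by rewrite [in RHS](big_setD1 x) //=; lia.
Qed.

Let exchange (B1 B2 : {set 'I_(m + r)}) x : #|B1| = #|B2| -> x \in B1 :\: B2 ->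
  exists2 y, y \in B2 :\: B1 & forall i,
    minn (cnt B1 i) (cnt B2 i) <= cnt (y |: (B1 :\ x)) i
      <= maxn (cnt B1 i) (cnt B2 i).
Proof.
move=> eqB; rewrite inE => /andP[xB2 xB1].
have := cntS B1 x; have := cntS B2 x; rewrite xB1 (negbTE xB2) => c2 c1.
have xs := ltn_ord x.
have [lt21|le12] := ltnP (cnt B2 x.+1) (cnt B1 x.+1).
  have ex : exists k, (x < k) && (cnt B1 k <= cnt B2 k).
    by exists (m + r); rewrite ltn_ord !cnt_full ?eqB /=.
  case: (ex_minnP ex) => -[|k] /andP[xk dk] mink; first by lia.
  have ks : k < m + r.
    by apply: mink; rewrite ltn_ord !cnt_full ?eqB /=.
  have xk' : x < k by move: xk dk; rewrite leq_eqVlt => /orP[/eqP[<-]|]; lia.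
  have below i : x < i -> i <= k -> cnt B2 i < cnt B1 i.
    move=> xi ik; rewrite ltnNge; apply/negP => di.
    by have := mink i; rewrite xi di => /(_ isT); lia.
  have := cntS B1 (Ordinal ks); have := cntS B2 (Ordinal ks) => /=.
  have := below k xk' (leqnn k).
  set y := Ordinal ks => dk' e2 e1.
  have [yB1 yB2] : y \notin B1 /\ y \in B2.
    by move: e1 e2; case: (y \in B1); case: (y \in B2) => /=; lia.
  exists y; first by rewrite inE yB1.
  move=> i; have := cnt_swap i xB1 yB1 => /=.
  by have := below i; case: (ltnP x i); case: (ltnP k i) => /=; lia.
have ex : exists k, (k <= x) && (cnt B2 k <= cnt B1 k).
  by exists 0; rewrite !cnt0.
have ub k : (k <= x) && (cnt B2 k <= cnt B1 k) -> k <= x by case/andP.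
case: (ex_maxnP ex ub) => k /andP[kx dk] maxk.
have kx' : k < x by move: kx dk; rewrite leq_eqVlt => /orP[/eqP->|//]; lia.
have above i : k < i -> i <= x -> cnt B1 i < cnt B2 i.
  move=> ki ix; rewrite ltnNge; apply/negP => di.
  by have := maxk i; rewrite ix di => /(_ isT); lia.
have ks : k < m + r by lia.
have := cntS B1 (Ordinal ks); have := cntS B2 (Ordinal ks) => /=.
have := above k.+1 (ltnSn k) kx'.
set y := Ordinal ks => dk' e2 e1.
have [yB1 yB2] : y \notin B1 /\ y \in B2.
  by move: e1 e2; case: (y \in B1); case: (y \in B2) => /=; lia.
exists y; first by rewrite inE yB1.
move=> i; have := cnt_swap i xB1 yB1 => /=.
by have := above i; case: (ltnP x i); case: (ltnP k i) => /=; lia.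
Qed.

Lemma lpm_bases_exchange P Q B1 B2 x :
  B1 \in lpm_bases P Q -> B2 \in lpm_bases P Q -> x \in B1 :\: B2 ->
  exists2 y, y \in B2 :\: B1 & y |: (B1 :\ x) \in lpm_bases P Q.
Proof.
move=> /imsetP[L1]; rewrite inE => /andP[/forallP PL1 /forallP L1Q] ->.
move=> /imsetP[L2]; rewrite inE => /andP[/forallP PL2 /forallP L2Q] -> xB.
have eqB : #|Nset (val L1)| = #|Nset (val L2)|.
  by rewrite (eqP (valP L1)) (eqP (valP L2)).
have [y yB btw] := exchange eqB xB; exists y => //.
set B := y |: _ in btw *.
pose t : (m + r).-tuple bool := [tuple i \in B | i < m + r].
have tB : Nset t = B by apply/setP => i; rewrite inE tnth_mktuple.
have rB : #|Nset t| == r.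
  move: (btw (m + r)); rewrite tB !cnt_full // -eqB minnn maxnn -eqn_leq.
  by rewrite (eqP (valP L1)) eq_sym.
apply/imsetP; exists (Sub t rB : lattice_path); last by rewrite SubK.
have nB i : nN i (Sub t rB) = cnt B i by rewrite /nN SubK tB.
have btwn i : minn (nN i L1) (nN i L2) <= nN i (Sub t rB)
    <= maxn (nN i L1) (nN i L2) by rewrite nB; apply: btw.
move: (Sub t rB) btwn => L btwn {nB rB tB t btw B yB y xB}.
rewrite inE; apply/andP; split; apply/forallP => i;
  have /andP[] := btwn i.+1; have := PL1 i; have := L1Q i;
  have := PL2 i; have := L2Q i.
  by move=> _ p2 _ p1 lo _; apply: leq_trans lo; rewrite leq_min p1 p2.
by move=> q2 _ q1 _ _ /leq_trans; apply; rewrite geq_max q1 q2.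
Qed.

Definition lpm (P Q : lattice_path) (PQ : path_le P Q) : matroid 'I_(m + r) :=
  Matroid (lpm_bases_neq0 PQ) (@lpm_bases_exchange P Q).

End LatticePath.

(* The class is closed under isomorphism. *)
Definition lattice_path_matroid : matroid_class := fun E M =>
  exists (m r : nat) (P Q : lattice_path m r) (PQ : path_le P Q),
    isomorphic M (lpm PQ).

(* Main.v *)
Require Import Defs.
From mathcomp Require Import all_boot.
From mathcomp Require Import zify boolp.

(** Let [P] and [Q] be the bounding paths of a lattice path matroid. At position
   [t] let [k] be the difference of their heights.

   First, [k] controls the number of classes of the initial segment U of length
   [t]. A subset X of U can be extended by a subset Z of the complement precisely
   when some path between [P] and [Q] has N steps at all positions of X and of Z.
   The lowest path through X that stays above [P] is the best choice up to [t], so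
   the class of X depends only on the height at which this path arrives, or on
   X being dependent ([prefix_class_sim]). There are at most [k] + 1 heights.

   Second, branch-width controls [k]. The [k] by [k] square with opposite corners
   on [P] and [Q] at position [t] lies between the paths, which makes the uniform
   matroid of rank [k] on [2k] elements a minor of the matroid; this minor is used
   only through the inequality [lambda_window]. In every decomposition some edge
   has a third of these [2k] elements on each side ([balanced_edge]), and at that
   edge the connectivity is at least two thirds of [k]. So branch-width at most
   [l] implies that [k] is at most 2[l] at all positions ([height_gap_le]).

   Third, the caterpillar whose leaves are the elements in their natural order
   displays only initial segments, singletons and the complements of these
   ([caterpillar_displayed]). A set and its complement bound each other's number
   of classes exponentially ([num_classes_setC]), so the caterpillar shows that the
   decomposition-width is at most 2 ^ (2[l] + 2). *)

Set Implicit Arguments.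
Unset Strict Implicit.
Unset Printing Implicit Defensive.

(** * Widths as minima over decompositions *)

Lemma min_nat_le (S : nat -> Prop) k : S k -> min_nat S <= k.
Proof.
move=> Sk; rewrite /min_nat; case: pselect => // exS.
by case: ex_minnP => i _; apply; apply/asboolP.
Qed.

Lemma min_natP (S : nat -> Prop) k : S k -> S (min_nat S).
Proof.
move=> Sk; rewrite /min_nat; case: pselect => [exS|[]].
  by case: ex_minnP => i /asboolP.
by exists k; apply/asboolP.
Qed.

Lemma decomposition_width_le (E : finType) (M : matroid E) (D : decomposition E) N :
  (forall u v, adj u v -> num_classes M (displayed (D := D) u v) <= N) ->
  decomposition_width M <= N.
Proof.
move=> leN; apply: leq_trans (min_nat_le (ex_intro _ D erefl)) _.
by apply/bigmax_leqP => -[u v] /= /leN.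
Qed.

Lemma decomposition_width_le_all (E : finType) (M : matroid E) N :
  (forall U, num_classes M U <= N) -> decomposition_width M <= N.
Proof.
move=> leN; have [[D _]|noD] := pselect (exists D : decomposition E, True).
  exact: (decomposition_width_le (D := D)).
rewrite /decomposition_width /min_nat; case: pselect => // exS.
by have [k /asboolP[D _]] := exS; case: noD; exists D.
Qed.

Lemma branch_width_attained (E : finType) (M : matroid E) (D0 : decomposition E) l :
  branch_width M <= l ->
  exists D : decomposition E,
    forall u v, adj u v -> lambda M (displayed (D := D) u v) < l.
Proof.
pose w (D : decomposition E) := max_displayed (fun U => (lambda M U).+1) D.
have [D Dbw] : exists D, w D = branch_width M.
  by apply: (@min_natP (fun k => exists D, w D = k) (w D0)); exists D0.
rewrite -Dbw => le_l; exists D => u v uv; apply: leq_trans le_l.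
exact: (leq_bigmax_cond (F := fun uv => (lambda M (displayed uv.1 uv.2)).+1) (u, v)).
Qed.

(** * Sides of the edges of a tree *)

Section TreeSides.
Variables (V : finType) (e : rel V).
Hypothesis tree_e : is_tree e.

Definition side u v : {set V} := [set x | connect (delete_edge e u v) u x].

Let e_sym : symmetric e. Proof. by case: tree_e. Qed.

Lemma side_refl u v : u \in side u v.
Proof. by rewrite inE connect0. Qed.

Lemma side_step u v x y :
  x \in side u v -> e x y -> [set x; y] != [set u; v] -> y \in side u v.
Proof.
rewrite !inE => ux exy xy; apply: connect_trans ux _.
by apply: connect1; rewrite /delete_edge /= exy.
Qed.

Lemma side_closed (A : {set V}) u v : u \in A ->
  (forall x y, e x y -> [set x; y] != [set u; v] -> x \in A -> y \in A) ->
  side u v \subset A.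
Proof.
move=> uA clA; apply/subsetP => x; rewrite inE => /connectP[p + ->] {x}.
suff ind w : w \in A -> path (delete_edge e u v) w p -> last w p \in A.
  exact: ind.
elim: p w => [|y p IHp] w wA //= /andP[/andP[ewy wy] /IHp]; apply.
exact: clA ewy wy wA.
Qed.

Lemma side_cover u v x : (x \in side u v) || (x \in side v u).
Proof.
have conn : connect e u x by case: tree_e.
have {conn} /connectP[p + ->] := conn => {x}.
suff ind w : w \in side u v :|: side v u -> path e w p ->
    last w p \in side u v :|: side v u.
  by rewrite -in_setU; apply: ind; rewrite inE side_refl.
elim: p w => [|y p IHp] w wA //= /andP[ewy /IHp]; apply.
have [/setP eq_uv|ne_uv] := eqVneq [set w; y] [set u; v].
  have := eq_uv y; rewrite !inE eqxx orbT => /esym/orP[]/eqP->;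
  by rewrite connect0 ?orbT.
move: wA; rewrite !in_setU => /orP[] wA; first by rewrite (side_step wA).
by rewrite orbC (side_step wA) // [RHS in _ != RHS]setUC.
Qed.

(** Otherwise a path avoiding the edge would close up to a cycle. *)
Lemma side_notin u v : e u v -> v \notin side u v.
Proof.
case: tree_e => _ irr _ _ acyc euv; rewrite inE.
apply/negP => /connectP[p0 path0 def_v].
move: path0 def_v; case/shortenP => p path_p uniq_p _ {p0} def_v.
have path_e : path e u p by apply: sub_path path_p => x y /andP[].
have : size (u :: p) <= 2.
  apply: acyc; rewrite /ucycle /cycle rcons_path path_e -def_v e_sym euv.
  exact: uniq_p.
case: p path_p def_v {uniq_p path_e} => [|y [|//]] /=.
  by move=> _ def_v; rewrite def_v irr in euv.
by rewrite andbT => /andP[_ ne] def_v; rewrite def_v eqxx in ne.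
Qed.

Lemma sideC u v : e u v -> side v u = ~: side u v.
Proof.
move=> euv; apply/eqP; rewrite eqEsubset; apply/andP; split; last first.
  apply/subsetP => x; rewrite in_setC => /negbTE xu.
  by have := side_cover u v x; rewrite xu.
apply: side_closed => [|x y exy ne]; first by rewrite in_setC; apply: side_notin.
rewrite !in_setC; apply: contra => yu; apply: (side_step yu); first by rewrite e_sym.
by rewrite setUC (setUC [set u]).
Qed.

(** A path from [a] that avoids the edge [av] never reaches [v], so it avoids
   the edge [uv] as well. *)
Lemma side_proper u v a : e u v -> e a v -> a != u -> side a v \proper side v u.
Proof.
move=> euv eav au; have vNa := side_notin eav.
have vu_sub : side a v \subset side v u :&: side a v.
  apply: side_closed => [|x y exy ne]; rewrite !in_setI.
    rewrite side_refl andbT; apply: (side_step (side_refl v u)).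
      by rewrite e_sym.
    apply/eqP => /setP/(_ a); rewrite !inE eqxx orbT (negbTE au) orbF.
    by move=> /esym/eqP av; move: eav; rewrite av; case: tree_e => _ ->.
  move=> /andP[xv xa]; have ya := side_step xa exy ne; rewrite ya andbT.
  apply: (side_step xv exy); apply/eqP => /setP/(_ v).
  rewrite !in_set2 eqxx /= => /orP[]/eqP def_v.
    by rewrite {1}def_v xa in vNa.
  by rewrite {1}def_v ya in vNa.
apply/properP; split; first by apply: subset_trans vu_sub _; apply: subsetIl.
by exists v => //; apply: side_refl.
Qed.

(** The first step [a] of a simple path from [v] to [x]: the rest of the path
   does not return to [v]. *)
Lemma side_neighbor v x : x != v -> exists2 a, e a v & x \in side a v.
Proof.
have /connectP[p0 path0 def_x] : connect e v x by case: tree_e.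
move: path0 def_x; case/shortenP => -[|a p] path_p uniq_p _ {p0} def_x.
  by rewrite def_x eqxx.
move=> _; move: path_p uniq_p => /= /andP[eva path_p] /and3P[vNp _ _].
exists a; first by rewrite e_sym.
rewrite inE def_x; apply/connectP; exists p => //.
apply: (@sub_in_path _ (predC1 v) e) path_p => [w y wv yv ewy|].
  rewrite /delete_edge /= ewy; apply/eqP => /setP/(_ v).
  by rewrite !in_set2 eqxx orbT !(eq_sym v) (negbTE wv) (negbTE yv).
by apply/allP => w wp; apply: contraNneq vNp => <-.
Qed.

End TreeSides.

(** Both sides together cover the tree, so it is enough that neither [A] nor its
   complement can be left without using the edge. *)
Lemma side_eq (V : finType) (e : rel V) (A : {set V}) u v :
  is_tree e -> e u v -> u \in A -> v \notin A ->
  (forall x y, e x y -> [set x; y] != [set u; v] -> x \in A -> y \in A) ->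
  side e u v = A.
Proof.
move=> tree_e euv uA vA clA; have e_sym : symmetric e by case: tree_e.
apply/eqP; rewrite eqEsubset (side_closed uA clA) /=.
rewrite -setCS -(sideC tree_e euv); apply: side_closed; first by rewrite in_setC.
move=> x y exy; rewrite [X in X != _]setUC [X in _ != X]setUC !in_setC => ne.
apply: contra => yA.
by apply: clA yA; rewrite 1?e_sym.
Qed.

(** * Balanced edges of subcubic trees *)

Section Balanced.
Variables (E : finType) (D : decomposition E).

Let tree_D : is_tree (@adj _ D). Proof. by case: (adj_subcubic D). Qed.

Lemma in_displayed u v x : (x \in displayed u v) = (phi D x \in side (@adj _ D) u v).
Proof. by rewrite !inE. Qed.

Lemma displayedC u v : adj u v -> displayed v u = ~: displayed (D:=D) u v.
Proof.
by move=> euv; apply/setP => x; rewrite in_setC !in_displayed (sideC tree_D) // in_setC.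
Qed.

Lemma leq_card_displayed (W : {set E}) u v :
  #|W| <= #|W :&: displayed (D:=D) u v| + #|W :&: displayed v u|.
Proof.
apply: leq_trans (leq_card_setU _ _); rewrite -setIUr subset_leq_card //.
apply/subsetP => x xW; rewrite in_setI in_setU xW !in_displayed.
exact: side_cover.
Qed.

(** If every edge had a side with less than a third of [W], then each edge would
   have exactly one big side. Choose an edge [uv] whose big side, the one of [v],
   has as few nodes as possible. The other edges at [v] are small away from [v],
   so if [v] has degree three, then [W] is covered by three small sides, which
   is impossible by counting; and if [v] is a leaf, its side contains at most one
   element, which is not a third of four or more. *)
Lemma balanced_edge (W : {set E}) : 3 < #|W| ->
  exists u v, [/\ adj u v, #|W| <= 3 * #|W :&: displayed (D:=D) u v|
    & #|W| <= 3 * #|W :&: displayed v u|].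
Proof.
move=> W3; pose big u v := #|W| <= 3 * #|W :&: displayed (D:=D) u v|.
have [/existsP[[u v] /and3P[/= euv bu bv]]|noneB] := boolP
  [exists uv : node D * node D, [&& adj uv.1 uv.2, big uv.1 uv.2 & big uv.2 uv.1]].
  by exists u, v.
have small u v : adj u v -> big v u -> ~~ big u v.
  move=> euv bv; apply: contra noneB => bu.
  by apply/existsP; exists (u, v); rewrite /= euv bu.
pose P (uv : node D * node D) := adj uv.1 uv.2 && big uv.2 uv.1.
have [uv0 Puv0] : exists uv, P uv.
  have /card_gt0P[x xW] : 0 < #|W| by lia.
  have : leaf (@adj _ D) (phi D x) by have /= := phi_leaves (phi D x); rewrite codom_f.
  move=> /cards1P[y /setP/(_ y)]; rewrite !inE eqxx => exy.
  have [bx|nbx] := boolP (big (phi D x) y).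
    exists (y, phi D x); rewrite /P /= bx andbT.
    by case: tree_D => ->.
  exists (phi D x, y); rewrite /P /= exy /=.
  by have := leq_card_displayed W (phi D x) y; move: nbx; rewrite /big; lia.
pose size_side (uv : node D * node D) := #|side (@adj _ D) uv.2 uv.1|.
have [[u v] /andP[/= euv bv] minuv] := @arg_minnP _ uv0 P size_side Puv0.
have e_sym : symmetric (@adj _ D) by case: tree_D.
have nbr a : a != u -> adj a v -> ~~ big a v.
  move=> au eav; apply/negP => ba; have := minuv (v, a).
  rewrite /P /size_side /= e_sym eav ba => /(_ isT).
  by rewrite leqNgt (proper_card (side_proper tree_D euv eav au)).
have nbu := small _ _ euv bv.
case: (adj_subcubic D) => _ /(_ v)[] deg_v; last first.
  have /cards1P[u' /setP nbr1] := introT eqP deg_v.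
  have leu a : adj a v -> a = u'.
    by move=> eav; have := nbr1 a; rewrite !inE e_sym eav => /esym/eqP.
  suff : #|W :&: displayed (D:=D) v u| <= 1 by move: bv; rewrite /big; lia.
  apply/card_le1_eqP => x y.
  suff toV z : z \in W :&: displayed (D:=D) v u -> phi D z = v.
    by move=> /toV xv /toV yv; apply: (@phi_inj _ D); rewrite xv yv.
  rewrite in_setI in_displayed (sideC tree_D) // in_setC => /andP[_ zu].
  apply/eqP; apply: contraNT zu => /(side_neighbor tree_D)[a /leu->].
  by rewrite (leu u euv).
have vNleaf z : phi D z != v.
  apply/eqP => zv; have /= := phi_leaves (phi D z).
  by rewrite codom_f zv /leaf /in_mem /= deg_v.
have /cards2P[a [b [_ nbr2]]] : #|[set w | adj v w] :\ u| == 2.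
  have := cardsD1 u [set w | adj v w]; rewrite [X in _ = X + _](_ : _ = 1).
    by rewrite [LHS]deg_v; lia.
  by rewrite inE e_sym euv.
have [au eav] : a != u /\ adj a v.
  by move/setP/(_ a): nbr2; rewrite !inE eqxx /= e_sym => /andP.
have [bu ebv] : b != u /\ adj b v.
  by move/setP/(_ b): nbr2; rewrite !inE eqxx orbT /= e_sym => /andP.
have nba := nbr a au eav; have nbb := nbr b bu ebv.
suff : #|W| <= #|W :&: displayed (D:=D) u v| + #|W :&: displayed (D:=D) a v|
    + #|W :&: displayed (D:=D) b v| by move: nbu nba nbb; rewrite /big; lia.
apply: leq_trans (leq_trans (leq_card_setU _ _) (leq_add (leq_card_setU _ _) (leqnn _))).
apply/subset_leq_card/subsetP => z zW.
have [c ecv zc] := side_neighbor tree_D (vNleaf z).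
have : c \in u |: [set a; b] by rewrite -nbr2 !inE e_sym ecv andbT orbN.
by rewrite in_setU1 in_set2 => /or3P[]/eqP cE;
  rewrite !in_setU !in_setI zW !in_displayed -cE zc ?orbT.
Qed.

End Balanced.

(** * Caterpillar decompositions *)

(** Trees given by a parent function on an initial segment of the naturals that
   decreases at every vertex but the root 0. *)
Section ParentTree.
Variables (N : nat) (par : nat -> nat).
Hypothesis par_lt : forall v, 0 < v -> par v < v.

Definition parent_adj : rel 'I_N.+1 := fun u v =>
  ((0 < u) && (v == par u :> nat)) || ((0 < v) && (u == par v :> nat)).

Lemma parent_adjC : symmetric parent_adj.
Proof. by move=> u v; rewrite /parent_adj orbC. Qed.

(** The largest vertex of a cycle would have two distinct neighbours on it,
   both smaller, hence both equal to its parent. *)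
Lemma parent_acyclic : acyclic parent_adj.
Proof.
move=> c uc; rewrite leqNgt; apply/negP => c3.
have [x0 x0c] : exists x, x \in c.
  by case: c c3 {uc} => // x c; exists x; rewrite mem_head.
have [x xc maxx] := @arg_maxnP _ x0 (mem c) (@nat_of_ord _) x0c.
have [k q def_q] := rot_to xc.
have : ucycle parent_adj (x :: q) by rewrite -def_q rot_ucycle.
have : size (x :: q) > 2 by rewrite -def_q size_rot.
have {}maxx y : y \in q -> y <= x.
  by move=> yq; apply: maxx; rewrite /= -(mem_rot k) def_q inE yq orbT.
case: q maxx {def_q} => [|y q] // maxx; case/lastP: q maxx => [|q z] //= maxx _.
rewrite /ucycle /= -!cats1 !cat_path /= last_cat /=.
move=> /andP[/and3P[exy _ /andP[ezx _]]].
rewrite /= !mem_cat !inE.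
have ley : y <= x by apply: maxx; rewrite mem_head.
have lez : z <= x by apply: maxx; rewrite inE mem_rcons mem_head orbT.
move: exy ezx; rewrite /parent_adj => exy ezx.
have pary := @par_lt y; have parz := @par_lt z.
by rewrite -!(inj_eq val_inj) /=; lia.
Qed.

Lemma parent_is_tree : is_tree parent_adj.
Proof.
split; [exact: parent_adjC | | by rewrite card_ord | | exact: parent_acyclic].
  by move=> v; rewrite /parent_adj; have := @par_lt v; lia.
have root v : connect parent_adj v ord0.
  have [k] := ubnP (val v); elim: k v => // k IHk v vk.
  have [v0|v_gt0] := posnP (v : nat); first by rewrite (_ : v = ord0) //; apply: val_inj.
  have parv := par_lt v_gt0.
  have lt_par : par v < N.+1 by have := ltn_ord v; lia.
  apply: (connect_trans (y := Ordinal lt_par)); last first.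
    by apply: IHk; apply: leq_trans parv vk.
  by apply: connect1; rewrite /parent_adj /= v_gt0 eqxx.
move=> u v; apply: connect_trans (root u) _.
by rewrite (sym_connect_sym parent_adjC).
Qed.

End ParentTree.

Section Caterpillar.
Variable n : nat.
Hypothesis n_gt1 : 1 < n.

Let N := 2 * n - 3.

(** Node 0 and the odd nodes form a path 0, 1, 3, ..., [N], and each even node
   2i > 0 is a leaf attached to the node 2i - 1. The leaves, in increasing order,
   are thus 0, 2, ..., [N] - 1, [N]. *)
Definition caterpillar_parent v := v - 1 - odd v.

Definition caterpillar_adj : rel 'I_N.+1 := parent_adj caterpillar_parent.

Lemma caterpillar_parent_lt v : 0 < v -> caterpillar_parent v < v.
Proof. by rewrite /caterpillar_parent; lia. Qed.

Let tree_caterpillar : is_tree caterpillar_adj.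
Proof. exact: parent_is_tree caterpillar_parent_lt. Qed.

Lemma caterpillar_degree v : degree caterpillar_adj v = if odd v && (v < N) then 3 else 1.
Proof.
have vN : v <= N by rewrite -ltnS ltn_ord.
have val_eq (x y : 'I_N.+1) : (x == y) = (x == y :> nat) by [].
rewrite /degree; case: ifP => [/andP[v_odd v_lt]|v_end].
  pose a : 'I_N.+1 := inord (caterpillar_parent v).
  pose b : 'I_N.+1 := inord v.+1; pose c : 'I_N.+1 := inord v.+2.
  have aE : a = caterpillar_parent v :> nat by rewrite inordK // /caterpillar_parent; lia.
  have bE : b = v.+1 :> nat by rewrite inordK //; lia.
  have cE : c = v.+2 :> nat by rewrite inordK //; lia.
  rewrite (_ : [set w | _] = a |: [set b; c]); last first.
    apply/setP => w; rewrite !inE !val_eq aE bE cE.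
    by rewrite /caterpillar_adj /parent_adj /caterpillar_parent; lia.
  by rewrite cardsU1 cards2 !inE !val_eq aE bE cE /caterpillar_parent; lia.
pose a : 'I_N.+1 := inord (if v == 0 :> nat then 1 else caterpillar_parent v).
have aE : a = (if v == 0 :> nat then 1 else caterpillar_parent v) :> nat.
  by rewrite inordK // /caterpillar_parent; case: ifP; lia.
rewrite (_ : [set w | _] = [set a]) ?cards1 //; apply/setP => w.
have wN : w <= N by rewrite -ltnS ltn_ord.
rewrite !inE !val_eq aE /caterpillar_adj /parent_adj /caterpillar_parent.
by case: ifP; lia.
Qed.

Definition caterpillar_phi (i : 'I_n) : 'I_N.+1 := inord (minn (2 * i) N).

Lemma caterpillar_phiE i : caterpillar_phi i = minn (2 * i) N :> nat.
Proof. by rewrite inordK // ltnS geq_minr. Qed.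

Lemma caterpillar_subcubic : subcubic_tree caterpillar_adj.
Proof. by split=> [//|v]; rewrite caterpillar_degree; case: ifP; [left|right]. Qed.

Lemma caterpillar_phi_inj : injective caterpillar_phi.
Proof.
move=> i j /(congr1 (@nat_of_ord _)); rewrite !caterpillar_phiE => eq_ij.
apply: val_inj; have := ltn_ord i; have := ltn_ord j.
by move: eq_ij; rewrite /N /=; lia.
Qed.

Lemma caterpillar_leaves : codom caterpillar_phi =i leaf caterpillar_adj.
Proof.
move=> v; rewrite -[RHS]topredE /= /leaf caterpillar_degree.
have vN : v <= N by rewrite -ltnS ltn_ord.
apply/codomP/idP => [[i ->]|].
  by rewrite caterpillar_phiE; have := ltn_ord i; case: ifP; rewrite /N; lia.
case: ifP => // v_end _.
have lt_n : uphalf v < n by move: v_end vN; rewrite /N; lia.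
exists (Ordinal lt_n); apply: val_inj; rewrite /= caterpillar_phiE /=.
by move: v_end vN; rewrite /N; lia.
Qed.

Definition caterpillar : decomposition 'I_n :=
  Decomposition caterpillar_subcubic caterpillar_phi_inj caterpillar_leaves.

(** The descendants of an odd node [u] are the nodes from [u] on, so the leaves
   among them form a final segment; an even node other than the root has no
   proper descendant. *)
Lemma caterpillar_displayed (u v : node caterpillar) :
  0 < u -> v = caterpillar_parent u :> nat ->
  displayed u v = if odd u then [set i : 'I_n | u./2 < i]
                  else [set i : 'I_n | i == u./2 :> nat].
Proof.
move=> u_gt0 vE; have uN : u <= N by rewrite -ltnS ltn_ord.
have val_eq (x y : 'I_N.+1) : (x == y) = (x == y :> nat) by [].
pose A : {set 'I_N.+1} := [set w : 'I_N.+1 | if odd u then u <= w else w == u :> nat].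
have sideA : side caterpillar_adj u v = A.
  apply: side_eq => //.
  - by rewrite /caterpillar_adj /parent_adj vE u_gt0 eqxx.
  - by rewrite inE; case: ifP.
  - by rewrite inE vE /caterpillar_parent; case: ifP; lia.
  move=> x y exy ne; rewrite !inE.
  have {}ne : x = u :> nat -> y <> v :> nat.
    by move=> /val_inj xu /val_inj yv; rewrite xu yv eqxx in ne.
  move: ne; rewrite vE /caterpillar_parent; case/orP: exy => /andP[w_gt0 /eqP];
    rewrite /caterpillar_parent => eq_xy ne; case: ifP => u_odd; lia.
have NE : N = 2 * n - 3 by [].
apply/setP => i.
have -> : (i \in displayed u v) = (caterpillar_phi i \in A).
  by rewrite -sideA in_displayed.
have lt_in := ltn_ord i.
by rewrite inE caterpillar_phiE; case: ifP => u_odd; rewrite inE; lia.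
Qed.

End Caterpillar.

(** * Counting classes *)

Lemma card_set_of (T : finType) : #|{set T}| = 2 ^ #|T|.
Proof. by rewrite -(cardsT T) -card_powerset powersetT cardsT. Qed.

Section MatroidBasics.
Variables (E : finType) (M : matroid E).
Implicit Types U X Y Z : {set E}.

Lemma indep_sub X Y : X \subset Y -> indep M Y -> indep M X.
Proof.
move=> XY /existsP[B /andP[BM YB]]; apply/existsP; exists B.
by rewrite BM (subset_trans XY).
Qed.

Lemma card_le_rank U X : X \subset U -> indep M X -> #|X| <= rank M U.
Proof.
by move=> XU iX; apply: leq_bigmax_cond; rewrite powersetE XU.
Qed.

Lemma simE U X X' Z : sim M U X X' -> Z \subset ~: U ->
  indep M (X :|: Z) = indep M (X' :|: Z).
Proof.
move=> /forallP/(_ Z)/implyP simX ZU.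
by have /eqP : indep M (X :|: Z) == indep M (X' :|: Z)
  by apply: simX; rewrite powersetE.
Qed.

Lemma simI U X X' :
  (forall Z, Z \subset ~: U -> indep M (X :|: Z) = indep M (X' :|: Z)) ->
  sim M U X X'.
Proof.
by move=> eqX; apply/forallP => Z; apply/implyP; rewrite powersetE => /eqX->.
Qed.

Definition refines_sim U (T : Type) (f : {set E} -> T) :=
  {in powerset U &, forall X X', f X = f X' -> sim M U X X'}.

Lemma mem_refines_sim x : refines_sim [set x] (fun X : {set E} => x \in X).
Proof.
move=> X X'; rewrite !powersetE !subset1.
by move=> /orP[]/eqP-> /orP[]/eqP->; rewrite ?inE ?eqxx // => _; apply: simI.
Qed.

Lemma num_classes_le_imset U (T : finType) (f : {set E} -> T) :
  refines_sim U f -> num_classes M U <= #|f @: powerset U|.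
Proof.
move=> f_sim; pose cl X := [set Y in powerset U | sim M U X Y].
pose g t := if [pick X in powerset U | f X == t] is Some X then cl X else set0.
apply: leq_trans (leq_imset_card g _).
apply/subset_leq_card/subsetP => _ /imsetP[X XU ->].
apply/imsetP; exists (f X); rewrite ?imset_f // /g.
case: pickP => [X' /andP[X'U /eqP fX']|/(_ X)]; last by rewrite XU eqxx.
have simX := f_sim X' X X'U XU fX'.
apply/setP => Y; rewrite !inE; congr (_ && _).
by apply/idP/idP => simY; apply: simI => Z ZU; rewrite -(simE simY ZU) (simE simX ZU).
Qed.

Lemma num_classes_le U (T : finType) (f : {set E} -> T) :
  refines_sim U f -> num_classes M U <= #|T|.
Proof. by move=> /num_classes_le_imset/leq_trans; apply; apply: max_card. Qed.

(** The class of a subset [Y] of the complement of [U] is determined by the set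
   of those classes of [U] whose members stay independent when [Y] is added. *)
Lemma num_classes_setC U (T : finType) (f : {set E} -> T) :
  refines_sim U f -> num_classes M (~: U) <= 2 ^ #|T|.
Proof.
move=> f_sim.
pose g Y := [set f X | X : {set E} in powerset U & indep M (X :|: Y)].
have gP Y X : Y \subset ~: U -> X \subset U -> (f X \in g Y) = indep M (X :|: Y).
  move=> YU XU; apply/imsetP/idP => [[X']|iXY]; last first.
    by exists X; rewrite ?inE ?XU.
  rewrite inE => /andP[X'U iX'Y] fX; rewrite (simE (U := U) (X' := X')) //.
  by apply: f_sim fX; rewrite // powersetE.
rewrite -card_set_of; apply: (num_classes_le (f := g)) => Y Y'.
rewrite !powersetE => YU Y'U eq_g.
by apply: simI => Z; rewrite setCK => ZU; rewrite !(setUC _ Z) -!gP // eq_g.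
Qed.

End MatroidBasics.

(** * Invariance under isomorphism *)

Section Isomorphism.
Variables (E E' : finType) (M : matroid E) (M' : matroid E') (f : E -> E').
Hypothesis f_bij : bijective f.
Hypothesis f_bases : forall B : {set E}, (B \in bases M) = (f @: B \in bases M').

Let f_inj : injective f := bij_inj f_bij.

Lemma imset_bij : bijective (fun X : {set E} => f @: X).
Proof.
have [g fK gK] := f_bij.
by exists (fun X : {set E'} => g @: X) => X;
  rewrite -imset_comp -[RHS]imset_id; apply: eq_imset.
Qed.

Lemma imset_setC (U : {set E}) : f @: (~: U) = ~: (f @: U).
Proof.
have [g fK gK] := f_bij; apply/setP => y; rewrite -(gK y) in_setC.
by rewrite !mem_imset // in_setC.
Qed.

Lemma sub_imset (X Y : {set E}) : (f @: X \subset f @: Y) = (X \subset Y).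
Proof.
apply/idP/idP => [/subsetP sXY|]; last exact: imsetS.
by apply/subsetP => x xX; rewrite -(mem_imset Y x f_inj) sXY ?imset_f.
Qed.

Lemma indep_iso X : indep M X = indep M' (f @: X).
Proof.
have [h hK Kh] := imset_bij.
apply/existsP/existsP => [] [B /andP[BM XB]].
  by exists (f @: B); rewrite -f_bases BM sub_imset.
by exists (h B); rewrite f_bases -sub_imset Kh BM.
Qed.

Lemma rank_iso U : rank M U = rank M' (f @: U).
Proof.
rewrite /rank [RHS](reindex _ (onW_bij _ imset_bij)) /=.
apply: eq_big => [X|X _]; last by rewrite card_imset.
by rewrite !powersetE sub_imset indep_iso.
Qed.

Lemma lambda_iso U : lambda M U = lambda M' (f @: U).
Proof.
by rewrite /lambda !rank_iso imset_setC -setC0 imset_setC imset0 setC0.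
Qed.

Lemma num_classes_iso_le U : num_classes M U <= num_classes M' (f @: U).
Proof.
pose cl (X : {set E}) := [set Y in powerset (f @: U) | sim M' (f @: U) (f @: X) Y].
apply: leq_trans (num_classes_le_imset (f := cl) _) _; last first.
  rewrite /num_classes; apply/subset_leq_card/subsetP => C /imsetP[X].
  rewrite powersetE => XU ->; rewrite /equivalence_partition.
  by apply/imsetP; exists (f @: X); rewrite ?powersetE ?sub_imset.
move=> X X'; rewrite !powersetE => XU X'U /setP/(_ (f @: X')).
rewrite !inE !sub_imset X'U /= => eq_cl.
have /simE sXX' : sim M' (f @: U) (f @: X) (f @: X').
  by rewrite eq_cl; apply: simI.
apply: simI => Z ZU; rewrite !indep_iso !imsetU; apply: sXX'.
by rewrite -imset_setC sub_imset.
Qed.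

(** The same tree, with leaves relabelled along [f]. *)
Lemma decomposition_iso (D : decomposition E') :
  exists D0 : decomposition E, forall (g : {set E} -> nat) (g' : {set E'} -> nat),
    (forall U, g U = g' (f @: U)) -> max_displayed g D0 = max_displayed g' D.
Proof.
have leaves : codom (phi D \o f) =i leaf (@adj _ D).
  move=> v; rewrite -(phi_leaves v); have [h fK hK] := f_bij.
  by apply/codomP/codomP => -[x ->]; [exists (f x) | exists (h x); rewrite /= hK].
exists (Decomposition (adj_subcubic D) (inj_comp (@phi_inj _ D) f_inj) leaves).
move=> g g' gg'; apply: eq_bigr => -[u v] _; rewrite gg'; congr (g' _).
have [h fK hK] := f_bij; apply/setP => y; rewrite -(hK y) mem_imset //.
by rewrite !inE.
Qed.

End Isomorphism.

Lemma isomorphic_sym (E E' : finType) (M : matroid E) (M' : matroid E') :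
  isomorphic M M' -> isomorphic M' M.
Proof.
case=> f f_bij f_bases; have [g fK gK] := f_bij; exists g; first by exists f.
move=> B; rewrite f_bases -imset_comp (eq_imset (g := id)) ?imset_id //.
Qed.

Lemma num_classes_iso (E E' : finType) (M : matroid E) (M' : matroid E') f :
  bijective f -> (forall B : {set E}, (B \in bases M) = (f @: B \in bases M')) ->
  forall U, num_classes M U = num_classes M' (f @: U).
Proof.
move=> f_bij f_bases U; have [g fK gK] := f_bij.
have g_bases (B : {set E'}) : (B \in bases M') = (g @: B \in bases M).
  by rewrite f_bases -imset_comp (eq_imset (g := id)) ?imset_id.
have g_bij : bijective g by exists f.
apply/eqP; rewrite eqn_leq num_classes_iso_le //.
apply: leq_trans (num_classes_iso_le g_bij g_bases _) _.
by rewrite -imset_comp (eq_imset (g := id)) ?imset_id.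
Qed.

Lemma width_iso (E E' : finType) (M : matroid E) (M' : matroid E') :
  isomorphic M M' ->
  branch_width M = branch_width M' /\ decomposition_width M = decomposition_width M'.
Proof.
move=> isoM; have [f f_bij f_bases] := isoM.
have [f' f'_bij f'_bases] := isomorphic_sym isoM.
split; congr (min_nat _); apply: funext => k; apply: propext; split=> -[D <-].
- have [D' /(_ _ (fun U => (lambda M U).+1)) eqD] := decomposition_iso f'_bij D.
  exists D'; apply: eqD => U; congr S; exact: lambda_iso.
- have [D' /(_ _ (fun U => (lambda M' U).+1)) eqD] := decomposition_iso f_bij D.
  exists D'; apply: eqD => U; congr S; exact: lambda_iso.
- have [D' eqD] := decomposition_iso f'_bij D.
  exists D'; apply: eqD; exact: num_classes_iso.
have [D' eqD] := decomposition_iso f_bij D.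
by exists D'; apply: eqD; apply: num_classes_iso.
Qed.

(** * Counting elements below a position *)

Lemma subset_between (T : finType) (A B : {set T}) k :
  A \subset B -> #|A| <= k <= #|B| ->
  exists C : {set T}, [/\ A \subset C, C \subset B & #|C| = k].
Proof.
move=> AB /andP[Ak kB]; have cardB := cardsID A B; rewrite (setIidPr AB) in cardB.
have : 0 < #|[set C : {set T} | C \subset B :\: A & #|C| == k - #|A|]|.
  by rewrite cards_draws bin_gt0; lia.
move=> /card_gt0P[C]; rewrite inE subsetD => /andP[/andP[CB CA] /eqP Ck].
exists (A :|: C); split; first exact: subsetUl.
  by rewrite subUset AB.
have [_] := leq_card_setU A C.
by rewrite disjoint_sym CA => /eqP->; rewrite Ck subnKC.
Qed.

Section Counting.
Variable n : nat.
Implicit Types B : {set 'I_n}.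

(** Membership at positions given as naturals, so that path heights can be
   computed by recursion on the position. *)
Definition mem_nat B (j : nat) := j \in [seq val i | i in B].

Lemma mem_natE B (i : 'I_n) : mem_nat B i = (i \in B).
Proof. by rewrite /mem_nat (mem_map val_inj) mem_enum. Qed.

Lemma mem_natP B (j : nat) :
  reflect (exists2 i : 'I_n, i \in B & j = i :> nat) (mem_nat B j).
Proof.
apply: (iffP mapP) => -[i iB ->]; exists i => //; first by rewrite mem_enum in iB.
by rewrite mem_enum.
Qed.

Lemma mem_nat_set (p : pred nat) j : j < n -> mem_nat [set i : 'I_n | p i] j = p j.
Proof. by move=> jn; rewrite (mem_natE _ (Ordinal jn)) inE. Qed.

Lemma mem_nat_big B j : n <= j -> mem_nat B j = false.
Proof. by move=> nj; apply/negbTE/mem_natP => -[i _ ji]; have := ltn_ord i; lia. Qed.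

Lemma mem_natU B B' j : mem_nat (B :|: B') j = mem_nat B j || mem_nat B' j.
Proof.
have [nj|jn] := leqP n j; first by rewrite !mem_nat_big.
by rewrite !(mem_natE _ (Ordinal jn)) in_setU.
Qed.

Definition count_below B j := #|[set i in B | i < j]|.

Lemma count_below0 B : count_below B 0 = 0.
Proof. by apply/eqP; rewrite cards_eq0; apply/eqP/setP => i; rewrite !inE andbF. Qed.

Lemma count_belowS B j : count_below B j.+1 = count_below B j + mem_nat B j.
Proof.
have [nj|jn] := leqP n j.
  rewrite mem_nat_big // addn0; congr #|pred_of_set _|; apply/setP => i.
  by rewrite !inE; have := ltn_ord i; case: (_ \in _) => //=; lia.
pose i0 := Ordinal jn; rewrite (mem_natE B i0) /count_below.
rewrite (cardsD1 i0) inE /= ltnSn andbT addnC; congr (_ + _).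
congr #|pred_of_set _|; apply/setP => i; rewrite !inE -(inj_eq val_inj) /=.
by case: (i \in B); rewrite ?andbF //=; lia.
Qed.

Lemma count_below_full B j : n <= j -> count_below B j = #|B|.
Proof.
move=> nj; congr #|pred_of_set _|; apply/setP => i.
by rewrite inE (leq_trans (ltn_ord i) nj) andbT.
Qed.

Lemma count_below_lip B i j : i <= j ->
  count_below B i <= count_below B j <= count_below B i + (j - i).
Proof.
move=> /subnKC <-; move: (j - i) => d; elim: d => [|d IHd].
  by rewrite addn0 subnn addn0 leqnn.
by move: IHd; rewrite addnS count_belowS; case: (mem_nat _ _); lia.
Qed.

Lemma count_belowD B B' j : B \subset B' ->
  count_below B' j = count_below B j + count_below (B' :\: B) j.
Proof.
move=> BB'; rewrite /count_below -(cardsID B); congr (_ + _);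
  congr #|pred_of_set _|; apply/setP => i; rewrite !inE.
  by have := subsetP BB' i; case: (i \in B) => [->|_]; rewrite ?andbT ?andbF.
by rewrite andbA.
Qed.

Lemma count_below_le B j : count_below B j <= #|B|.
Proof. by apply/subset_leq_card/subsetP => i; rewrite inE => /andP[]. Qed.

(** A height function that starts at 0 and increases by at most one per position
   counts the positions at which it rises. Sets of positions are defined below as
   the rises of explicit height functions: their sizes are then values of these
   functions. *)
Lemma count_below_rises h j : h 0 = 0 ->
  (forall i, i < n -> h i <= h i.+1 <= (h i).+1) -> j <= n ->
  count_below [set i : 'I_n | h i < h i.+1] j = h j.
Proof.
move=> h0 hS; elim: j => [|j IHj] jn; first by rewrite count_below0 h0.
rewrite count_belowS IHj; last exact: ltnW.
by rewrite (mem_nat_set (fun i => h i < h i.+1)) //; have := hS j jn; lia.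
Qed.

Lemma card_rises h : h 0 = 0 ->
  (forall i, i < n -> h i <= h i.+1 <= (h i).+1) ->
  #|[set i : 'I_n | h i < h i.+1]| = h n.
Proof. by move=> h0 hS; rewrite -(count_below_full _ (leqnn n)) count_below_rises. Qed.

End Counting.

(** * Independent sets of lattice path matroids *)

Section LatticePathMatroid.
Variables (m r : nat) (P Q : lattice_path m r) (PQ : Defs.path_le P Q).
Let n := m + r.
Let M := lpm PQ.
Implicit Types B K X Y Z U V : {set 'I_(m + r)}.

Lemma nNE (L : lattice_path m r) j : nN j L = count_below (Nset (val L)) j.
Proof. by []. Qed.

Lemma nN0 (L : lattice_path m r) : nN 0 L = 0. Proof. exact: count_below0. Qed.

Lemma nN_full (L : lattice_path m r) : nN n L = r.
Proof. by rewrite nNE (count_below_full _ (leqnn _)) (eqP (valP L)). Qed.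

Lemma nN_lip (L : lattice_path m r) i j : i <= j ->
  nN i L <= nN j L <= nN i L + (j - i).
Proof. exact: count_below_lip. Qed.

Lemma nN_le j : j <= n -> nN j P <= nN j Q.
Proof.
by case: j => [|j] jn; rewrite ?nN0 //; have /forallP/(_ (Ordinal jn)) := PQ.
Qed.

Lemma base_count B j : B \in bases M -> j <= n ->
  nN j P <= count_below B j <= nN j Q.
Proof.
move=> /imsetP[L]; rewrite inE => /andP[/forallP PL /forallP LQ] ->.
case: j => [|j] jn; first by rewrite !nN0 count_below0.
by rewrite (PL (Ordinal jn)) (LQ (Ordinal jn)).
Qed.

Lemma card_base B : B \in bases M -> #|B| = r.
Proof. by move=> /imsetP[L _ ->]; rewrite (eqP (valP L)). Qed.

Lemma rises_base h : h 0 = 0 ->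
  (forall i, i < n -> h i <= h i.+1 <= (h i).+1) ->
  (forall j, j <= n -> nN j P <= h j <= nN j Q) ->
  [set i : 'I_(m + r) | h i < h i.+1] \in bases M.
Proof.
move=> h0 hS hPQ; set B := [set i | _].
pose t : (m + r).-tuple bool := [tuple i \in B | i < m + r].
have tB : Nset t = B by apply/setP => i; rewrite inE tnth_mktuple.
have rB : #|Nset t| == r.
  by rewrite tB card_rises // -/n; have := hPQ n (leqnn n); rewrite !nN_full; lia.
apply/imsetP; exists (Sub t rB : lattice_path m r); last by rewrite SubK.
have nB j : j <= n -> nN j (Sub t rB : lattice_path m r) = h j.
  by move=> jn; rewrite nNE SubK tB; apply: count_below_rises.
by rewrite inE; apply/andP; split; apply/forallP => i; rewrite nB //;
  case/andP: (hPQ i.+1 (ltn_ord i)).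
Qed.

(** Height, after [j] letters, of the lowest path that stays above [P] and has
   an N at every position in [X]. *)
Fixpoint low X j :=
  if j is i.+1 then maxn (nN i.+1 P) (low X i + mem_nat X i) else 0.

Lemma low_ge X j : nN j P <= low X j.
Proof. by case: j => [|j] /=; rewrite ?nN0 // leq_maxl. Qed.

Lemma lowS X j : low X j + mem_nat X j <= low X j.+1 <= (low X j).+1.
Proof.
have := low_ge X j; have := nN_lip P (leqnSn j) => /=.
by case: (mem_nat _ _); lia.
Qed.

(** The lowest path through [X] above [P] exists whatever [Q] is; it is below
   every other path through [X], so [X] is independent as soon as this one path
   stays below [Q]. *)
Lemma indep_lpmP X :
  reflect (forall j, j <= n -> low X j <= nN j Q) (indep M X).
Proof.
apply: (iffP existsP) => [[B /andP[BM XB]] j jn|lowQ].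
  have /andP[_] := base_count BM jn; apply: leq_trans.
  elim: j jn => [|j IHj] jn //=.
  have := IHj (ltnW jn); have /andP[] := base_count BM jn; rewrite count_belowS.
  have : mem_nat X j <= mem_nat B j.
    rewrite !(mem_natE _ (Ordinal jn)); have := subsetP XB (Ordinal jn).
    by case: (_ \in X) => // ->.
  lia.
have lowM : [set i : 'I_(m + r) | low X i < low X i.+1] \in bases M.
  apply: rises_base => // [i _|j jn]; last by rewrite low_ge lowQ.
  by have := lowS X i; lia.
exists [set i : 'I_(m + r) | low X i < low X i.+1]; rewrite lowM.
by apply/subsetP => i iX; have := lowS X i; rewrite mem_natE iX inE; lia.
Qed.

(** Any height function [h] between [P] and [Q] that climbs at the positions in
   [X] bounds the lowest path from above; it may climb by more than one. *)
Lemma indep_lpm_under X h : h 0 = 0 ->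
  (forall j, j <= n -> nN j P <= h j <= nN j Q) ->
  (forall j, j < n -> h j + mem_nat X j <= h j.+1) -> indep M X.
Proof.
move=> h0 hPQ hS; apply/indep_lpmP => j jn.
have /andP[_] := hPQ j jn; apply: leq_trans.
elim: j jn => [|j IHj] jn //=.
by have := IHj (ltnW jn); have := hS j jn; have /andP[] := hPQ j.+1 jn; lia.
Qed.

(** ** Classes of initial segments *)

Section PrefixClasses.
Variables (t K : nat).
Hypotheses (t_le : t <= n) (width_t : nN t Q - nN t P <= K).
Let U := [set i : 'I_(m + r) | i < t].

(** An independent [X] matters beyond position [t] only through the lowest height
   at which a path containing [X] can arrive there. These heights lie between
   those of [P] and [Q], and the value [ord_max], which they do not reach, is left
   for the dependent sets. *)
Definition prefix_class X : 'I_K.+2 :=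
  if indep M X then inord (low X t - nN t P) else ord_max.

Lemma low_prefix X Z j : X \subset U -> Z \subset ~: U -> j <= t ->
  low (X :|: Z) j = low X j.
Proof.
move=> XU ZU; elim: j => [|j IHj] jt //=; rewrite IHj 1?ltnW // mem_natU.
rewrite [mem_nat Z j](_ : _ = false) ?orbF //; apply/negbTE/mem_natP => -[i].
by move=> /(subsetP ZU); rewrite !inE => it ji; lia.
Qed.

Lemma low_suffix X X' Z j : X \subset U -> X' \subset U -> Z \subset ~: U ->
  low X t = low X' t -> t <= j -> low (X :|: Z) j = low (X' :|: Z) j.
Proof.
move=> XU X'U ZU eq_t; elim: j => [|j IHj]; first by rewrite leqn0 => /eqP t0.
rewrite leq_eqVlt => /orP[/eqP<-|tj]; first by rewrite !low_prefix.
rewrite /= IHj // !mem_natU.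
have out Y : Y \subset U -> mem_nat Y j = false.
  move=> YU; apply/negbTE/mem_natP => -[i /(subsetP YU)].
  by rewrite inE => it ji; lia.
by rewrite (out X) // (out X').
Qed.

Lemma prefix_class_sim : refines_sim M U prefix_class.
Proof.
move=> X X'; rewrite !powersetE => XU X'U.
have lt_low Y : indep M Y -> low Y t - nN t P < K.+1.
  by move=> /indep_lpmP/(_ t t_le); have := low_ge Y t; have := width_t; lia.
have inord_low Y : indep M Y ->
    (inord (low Y t - nN t P) : 'I_K.+2) = low Y t - nN t P :> nat.
  by move=> iY; rewrite inordK // leqW ?lt_low.
have dep Y Z : indep M Y = false -> indep M (Y :|: Z) = false.
  by apply: contraFF; apply: indep_sub; apply: subsetUl.
rewrite /prefix_class => eq_cl; apply: simI => Z ZU.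
move: eq_cl; case: ifP => iX; case: ifP => iX'; last by rewrite !dep.
- move=> /(congr1 (@nat_of_ord _)); rewrite !inord_low // => eq_low.
  have eq_t : low X t = low X' t by have := low_ge X t; have := low_ge X' t; lia.
  have half Y Y' : Y \subset U -> Y' \subset U -> low Y t = low Y' t ->
      indep M Y' -> indep M (Y :|: Z) -> indep M (Y' :|: Z).
    move=> YU Y'U eqY /indep_lpmP iY' /indep_lpmP iYZ; apply/indep_lpmP => j jn.
    have [jt|tj] := leqP j t; first by rewrite low_prefix // iY'.
    by rewrite -(low_suffix YU) ?iYZ // ltnW.
  by apply/idP/idP; apply: half.
- by move=> /(congr1 (@nat_of_ord _)); rewrite inord_low //=; have := lt_low X iX; lia.
- by move=> /(congr1 (@nat_of_ord _)); rewrite inord_low //=; have := lt_low X' iX'; lia.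
Qed.

End PrefixClasses.

(** ** Connectivity around a position *)

(** Let [P] and [Q] have heights [a] and [b] = [a] + [k] at position [t]. These two
   points are opposite corners of a [k] by [k] square which lies between the two
   paths and occupies the [2k] positions around [t], the window. The frame
   collects the N steps, outside the window, of a path through the other two
   corners. Inside the square every path is allowed, so the frame together with
   any [k] positions of the window is a basis: contracting the frame and
   restricting to the window gives the uniform matroid of rank [k] on [2k]
   elements. *)
Section Window.
Variable t : nat.
Hypothesis t_le : t <= n.
Let a := nN t P.
Let b := nN t Q.
Let k := b - a.

Let ab : a <= b. Proof. exact: nN_le. Qed.
Let lo : k <= t. Proof. by have := nN_lip Q (leq0n t); rewrite nN0 -/b; lia. Qed.
Let hi : t + k <= n.
Proof.
by have := nN_lip P t_le; have := nN_lip Q t_le; rewrite !nN_full -/a -/b; lia.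
Qed.

(* Heights change by at most one per position. *)
Let near_t j : j <= n -> [/\ nN j P <= nN j Q,
  j <= t -> nN j P <= a /\ b <= nN j Q + (t - j)
  & t <= j -> nN j P <= a + (j - t) /\ b <= nN j Q].
Proof.
move=> jn; split; first exact: nN_le.
  by move=> ji; have := nN_lip P ji; have := nN_lip Q ji; rewrite -/a -/b; lia.
by move=> ij; have := nN_lip P ij; have := nN_lip Q ij; rewrite -/a -/b; lia.
Qed.

(* The number of positions of the window below [j]. *)
Let ramp j := minn (j - (t - k)) k.*2.
Definition window : {set 'I_(m + r)} :=
  [set i : 'I_(m + r) | ramp i < ramp i.+1].

Lemma card_window : #|window| = k.*2.
Proof. by rewrite card_rises /ramp; lia. Qed.

(* The number of elements of the frame below [j]. Left of the window the frame
   follows [Q] up to height [a]. Right of it the frame follows [P] from height [b]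
   on, and the [k] steps made inside the window are not counted. *)
Let frame_height j :=
  if j < t - k then minn (nN j Q) a
  else if j < t + k then a else maxn (nN j P) b - k.
Definition frame : {set 'I_(m + r)} :=
  [set i : 'I_(m + r) | frame_height i < frame_height i.+1].

Lemma card_frame : #|frame| = r - k.
Proof.
have := nN_lip Q t_le; have := nN_lip P t_le; rewrite !nN_full -/a -/b => lipP lipQ.
rewrite card_rises -/n /frame_height; first by rewrite !nN_full; do ?case: ifP => ?; lia.
  by rewrite !nN0; have := nN_lip Q (leq0n t); rewrite nN0 -/b; do ?case: ifP => ?; lia.
move=> i lt_in; have := nN_lip P (leqnSn i); have := nN_lip Q (leqnSn i).
have [] := near_t (ltnW lt_in); have [] := near_t lt_in.
do ?case: ifP => ?; lia.
Qed.

Lemma frame_window_disjoint : frame :&: window = set0.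
Proof.
apply/setP => i; have [_ _] := near_t (ltn_ord i); have [_] := near_t (ltnW (ltn_ord i)).
by rewrite !inE /frame_height /ramp; do ?case: ifP => ?; lia.
Qed.

Lemma indep_frame K : K \subset window -> #|K| <= k -> indep M (frame :|: K).
Proof.
move=> KW0 leK0; have [K1 [KK1 KW cardK]] : exists C : {set 'I_(m + r)},
    [/\ K \subset C, C \subset window & #|C| = k].
  by apply: subset_between KW0 _; rewrite leK0 card_window; lia.
(* With exactly [k] elements in the window, the path leaves the square at its
   upper right corner. *)
apply: indep_sub (setUS frame KK1) _; move: K1 {KK1 KW0 leK0 K} KW cardK => K KW cardK.
pose h j := if j < t - k then minn (nN j Q) a
  else if j < t + k then a + count_below K j else maxn (nN j P) b.
have W_ramp j : j <= n -> count_below window j = ramp j.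
  by move=> jn; apply: count_below_rises => // [|i _]; rewrite /ramp; lia.
have K_bounds j : j <= n -> ramp j - k <= count_below K j <= minn k (ramp j).
  move=> /W_ramp <-; have := count_below_le K j; have := count_below_le (window :\: K) j.
  have := cardsID K window; rewrite (setIidPr KW) card_window cardK.
  by have := count_belowD j KW; lia.
apply: (@indep_lpm_under _ h).
- rewrite /h !nN0 count_below0; have := nN_lip Q (leq0n t); rewrite nN0 -/b.
  by do ?case: ifP => ?; lia.
- move=> j jn; have := K_bounds j jn; have [] := near_t jn; rewrite /h /ramp.
  by do ?case: ifP => ?; lia.
move=> j jn; have memK : mem_nat K j -> ramp j < ramp j.+1.
  by rewrite (mem_natE _ (Ordinal jn)) => /(subsetP KW); rewrite inE.
rewrite mem_natU (mem_nat_set (fun i => frame_height i < frame_height i.+1)) //.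
have [j_lo|lo_j] := ltnP j (t - k).
  have -> : mem_nat K j = false by move: memK; rewrite /ramp; lia.
  have := nN_lip Q (leqnSn j).
  have [_ near_lo _] := near_t jn; have [|_ b_le] := near_lo; first by lia.
  rewrite /h /frame_height j_lo orbF; have [//|j_end] := ltnP j.+1 (t - k); first by lia.
  rewrite count_belowS; have := K_bounds j (ltnW jn).
  by rewrite /ramp; do ?case: ifP => ?; lia.
have [j_hi|hi_j] := ltnP j (t + k); last first.
  have -> : mem_nat K j = false by move: memK; rewrite /ramp; lia.
  have := nN_lip P (leqnSn j); have [_ _ /(_ _)[|_]] := near_t (ltnW jn); first by lia.
  have [_ _ /(_ _)[|_]] := near_t jn; first by lia.
  rewrite /h /frame_height orbF !ifF; lia.
have K_j := K_bounds j (ltnW jn); have := K_bounds j.+1 jn; rewrite count_belowS => K_Sj.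
have [nlo nloS] : (j < t - k) = false /\ (j.+1 < t - k) = false by lia.
rewrite /h /frame_height nlo nloS j_hi count_belowS.
have [_|end_j] := ltnP j.+1 (t + k); first by rewrite ltnn /= addnA.
have [_ _ near_hi] := near_t jn; have [|P_le _] := near_hi; first by lia.
by case: (mem_nat K j) K_Sj => /=; lia.
Qed.

(** Each set [V] has rank at least the size of its part of the frame plus the
   smaller of [k] and the size of its part of the window. Adding this up for [U]
   and its complement gives the bound, because the frame has [r - k] elements and
   the two parts of the window have [2k] together. *)
Lemma lambda_window U : minn #|window :&: U| #|window :&: ~: U| <= lambda M U.
Proof.
have cardW := cardsID U window; rewrite setDE card_window in cardW.
have le_half V : minn k #|window :&: V| + #|frame :&: V| <= rank M V.
  have [K [_ KWV cardK]] : exists C : {set 'I_(m + r)},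
      [/\ set0 \subset C, C \subset window :&: V & #|C| = minn k #|window :&: V|].
    by apply: subset_between; rewrite ?sub0set // cards0 geq_minr.
  have [KW KV] : K \subset window /\ K \subset V by apply/andP; rewrite -subsetI.
  have iK : indep M ((frame :&: V) :|: K).
    apply: indep_sub (indep_frame KW _); first exact: setSU (subsetIl _ _).
    by rewrite cardK geq_minl.
  rewrite -cardK addnC -cardsUI (_ : _ :&: K = set0) ?cards0 ?addn0.
    by apply: card_le_rank iK; rewrite subUset subsetIr.
  apply/eqP; rewrite -subset0 -frame_window_disjoint.
  by rewrite setISS // subsetIl.
have full : rank M [set: 'I_(m + r)] <= r.
  apply/bigmax_leqP => X /andP[_ /existsP[B /andP[BM XB]]].
  by have := subset_leq_card XB; rewrite (card_base BM).
have := le_half U; have := le_half (~: U); have := cardsID U frame.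
rewrite setDE card_frame; have := nN_lip Q t_le; rewrite nN_full /lambda -/b.
have := ab; rewrite /k in cardW *; lia.
Qed.

End Window.

End LatticePathMatroid.

(** * The pigeonhole property *)

(** A gap [k] > 2[l] at position [t] gives a window of [2k] elements. Some edge has
   at least two thirds of [k] of them on either side, hence [lambda] is at least
   two thirds of [k] there, which exceeds [l]. *)
Lemma height_gap_le m r (P Q : lattice_path m r) (PQ : Defs.path_le P Q) l
    (D : decomposition 'I_(m + r)) t : 0 < l -> t <= m + r ->
  (forall u v, adj u v -> lambda (lpm PQ) (displayed (D := D) u v) < l) ->
  nN t Q - nN t P <= 2 * l.
Proof.
move=> l_gt0 t_le lt_l; rewrite leqNgt; apply/negP => gt_2l.
have cardW := card_window PQ t_le.
have [|u [v [uv big_u big_v]]] := @balanced_edge _ D (window P Q t).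
  by rewrite cardW; lia.
have := lambda_window PQ t_le (displayed (D := D) u v).
rewrite -displayedC // cardW in big_u big_v *; have := lt_l u v uv.
lia.
Qed.

(** The caterpillar with the elements in their natural order displays, up to
   complements, only initial segments and singletons. An initial segment has at
   most 2[l] + 2 classes, one for each arrival height and one for the dependent
   sets; passing to the complement costs an exponential. *)
Lemma lpm_decomposition_width m r (P Q : lattice_path m r) (PQ : Defs.path_le P Q) l :
  0 < l -> branch_width (lpm PQ) <= l -> decomposition_width (lpm PQ) <= 2 ^ (2 * l).+2.
Proof.
move=> l_gt0 bw_l; set N := 2 ^ _.
have N4 : 4 <= N by rewrite /N 2!expnS; have := expn_gt0 2 (2 * l); lia.
(* A caterpillar needs two leaves; on fewer elements there are at most two subsets. *)
have [n_gt1|n_le1] := ltnP 1 (m + r); last first.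
  apply: decomposition_width_le_all => U.
  apply: leq_trans (num_classes_le (f := id) _) _.
    by move=> X X' _ _ ->; apply: simI.
  by rewrite card_set_of card_ord (leq_trans (leq_pexp2l _ n_le1)) //; lia.
have [D lt_l] := branch_width_attained (caterpillar n_gt1) bw_l.
have le_N (T : finType) (f : {set 'I_(m + r)} -> T) U : #|T| <= (2 * l).+2 ->
    refines_sim (lpm PQ) U f ->
    num_classes (lpm PQ) U <= N /\ num_classes (lpm PQ) (~: U) <= N.
  move=> leT f_sim; split; last first.
    by apply: leq_trans (num_classes_setC f_sim) _; rewrite leq_exp2l.
  apply: leq_trans (num_classes_le f_sim) _; apply: leq_trans leT _.
  exact: ltnW (ltn_expl _ _).
have tree_caterpillar : is_tree (@adj _ (caterpillar n_gt1)).
  by case: (adj_subcubic (caterpillar n_gt1)).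
apply: (decomposition_width_le (D := caterpillar n_gt1)).
have down (u v : node (caterpillar n_gt1)) : 0 < u -> v = caterpillar_parent u :> nat ->
    num_classes (lpm PQ) (displayed u v) <= N /\
    num_classes (lpm PQ) (~: displayed u v) <= N.
  move=> u_gt0 uv; rewrite (caterpillar_displayed u_gt0 uv).
  have uN : u <= 2 * (m + r) - 3 by rewrite -ltnS; exact: ltn_ord.
  case: ifP => u_odd.
    have t_le : u./2.+1 <= m + r by lia.
    have width_t := height_gap_le l_gt0 t_le lt_l.
    rewrite (_ : [set i : 'I_(m + r) | u./2 < i] = ~: [set i : 'I_(m + r) | i < u./2.+1]).
      rewrite setCK and_comm.
      by apply: le_N (prefix_class_sim t_le width_t); rewrite card_ord.
    by apply/setP => i; rewrite !inE -leqNgt.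
  have lt_n : u./2 < m + r by lia.
  rewrite (_ : [set i : 'I_(m + r) | _] = [set Ordinal lt_n]).
    by apply: (le_N bool _ _ _ (@mem_refines_sim _ _ _)); rewrite card_bool.
  by apply/setP => i; rewrite !inE.
move=> u v uv; have [/andP[u_gt0 /eqP/down[]] //|/andP[v_gt0 /eqP/down[]//]] := orP uv.
by rewrite -(displayedC (D := caterpillar n_gt1)) //; case: tree_caterpillar => ->.
Qed.

Theorem corollary7p4 : pigeonhole lattice_path_matroid.
Proof.
move=> l l_gt0; exists (2 ^ (2 * l).+2) => E M [m [r [P [Q [PQ isoM]]]]].
by have [-> ->] := width_iso isoM; apply: lpm_decomposition_width.
Qed.
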